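(* Up to coefficients, the $(2n)$th power of the twist on $\mathbb{C}[\mathrm{Gr}_{k,n}]$ is equal to the identity; that is, if $T$ denotes the endomorphism $f\mapsto\overleftarrow{f}$ of $\mathbb{C}[\mathrm{Gr}_{k,n}]$, then $\pi\circ T^{2n}=\pi$.
   Context: Let $1\le k\le n-1$. $M_{k,n}$ is the set of complex $k\times n$ matrices $p$ with columns $p_1,\dots,p_n$; for a $k$-subset $I$ of $\{1,\dots,n\}$, $[I]$ is the minor with column set $I$ in increasing order. $\mathbb{C}[\mathrm{Gr}_{k,n}]$ is the subalgebra of $\mathbb{C}[M_{k,n}]$ generated by all $[I]$. Let $\sigma(i)=i-1$ mod $n$ and $\mathbf{i}=\{\sigma^{k-1}(i),\dots,\sigma(i),i\}$; the $[\mathbf{i}]$, $1\le i\le n$, are called coefficients. **Twist.** For $v_1,\dots,v_{k-1}\in\mathbb{C}^k$, $v_1\times\cdots\times v_{k-1}$ is the unique vector with $(v_1\times\cdots\times v_{k-1})^Tv=\det(v_1,\dots,v_{k-1},v)$ for all $v$ (it is $1$ if $k=1$). $\overleftarrow{p}$ has $i$th column $\varepsilon_i\, p_{\sigma^{k-1}(i)}\times\cdots\times p_{\sigma(i)}$, with $\varepsilon_i=(-1)^{i(k-i)}$ if $i\le k-1$ and $\varepsilon_i=1$ if $i\ge k$; $\overleftarrow{f}(p)=f(\overleftarrow{p})$ for $f\in\mathbb{C}[\mathrm{Gr}_{k,n}]$. **Cluster structure and $\pi$.** Let $2\le k\le n-2$. For $0\le i\le k-1$, $1\le j\le n-k$,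 or $(i,j)=(0,0)$, let $M_{k,n}(i,j)=\{1,\dots,i\}\cup\{i+j+1,\dots,j+k\}$, with $M_{k,n}(0,0)=\{1,\dots,k\}$. $\mathbb{C}[\mathrm{Gr}_{k,n}]$ is a cluster algebra (of geometric type, coefficients not inverted) with an initial seed whose extended cluster consists of all $[M_{k,n}(i,j)]$. The cluster $\mathbf{x}(\mathcal{R}_{k,n})$ consists of those with $1\le i\le k-1$, $1\le j\le n-k-1$, and the others are exactly the coefficients $[\mathbf{1}],\dots,[\mathbf{n}]$ (frozen). Its quiver $\widetilde{Q}(\mathcal{R}_{k,n})$ has arrows $(i+1,j)\to(i,j)$, $(i,j)\to(i,j+1)$, $(i,j+1)\to(i+1,j)$ whenever both vertices are in the range $0\le i\le k-1,\ 1\le j\le n-k$ and not both are frozen, together with $(0,0)\to(k-1,1)$. Its principal part $Q(\mathcal{R}_{k,n})$ is the full subquiver on the non-frozen vertices. $\mathbb{C}[\mathrm{Gr}_{k,n}]_1$ is the cluster algebra (without coefficients) in $\mathbb{C}(\mathbf{x}(\mathcal{R}_{k,n}))$ with initial seed $(\mathbf{x}(\mathcal{R}_{k,n}),Q(\mathcal{R}_{k,n}))$. $\pi:\mathbb{C}[\mathrm{Gr}_{k,n}]\to\mathbb{C}[\mathrm{Gr}_{k,n}]_1$ is the surjective ring homomorphism sending every coefficient to $1$ and each element of $\mathbf{x}(\mathcal{R}_{k,n})$ to itself; it sends cluster variables to cluster variables and seeds (with frozen vertices removed) to seeds, compatibly with mutation. If $k=1$ or $k=n-1$, all Plücker coordinates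 are coefficients, $\mathbb{C}[\mathrm{Gr}_{k,n}]_1=\mathbb{C}$ and $\pi$ sends each $[I]$ to $1$. Two endomorphisms $\varphi_1,\varphi_2$ of $\mathbb{C}[\mathrm{Gr}_{k,n}]$ are equal up to coefficients if $\pi\circ\varphi_1=\pi\circ\varphi_2$. *)

(* Defs.v *)
From HB Require Import structures.
From mathcomp Require Import all_boot all_order all_fingroup all_algebra.
From mathcomp Require Import boolp reals.
From mathcomp Require Import complex zify.
From mathcomp Require Import mpoly.

Set Implicit Arguments.
Unset Strict Implicit.
Unset Printing Implicit Defensive.

Import Order.TTheory GRing.Theory Num.Theory.
Local Open Scope ring_scope.

Section GeneratedSubalgebra.
Variables (C A : comNzRingType) (iota : {rmorphism C -> A}) (S : A -> Prop).

(* The C-subalgebra of A generated by S, where C acts through iota; a ring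
   morphism is used because {fraction _} carries no algebra structure. *)
Inductive generated : A -> Prop :=
| generated_const c : generated (iota c)
| generated_gen a : S a -> generated a
| generated_add a b : generated a -> generated b -> generated (a + b)
| generated_mul a b : generated a -> generated b -> generated (a * b).

Definition generated_pred : {pred A} := fun a => `[< generated a >].

Record subalg := Subalg { subalg_val : A; _ : subalg_val \in generated_pred }.

HB.instance Definition _ := [isSub for subalg_val].
HB.instance Definition _ := [Choice of subalg by <:].

Lemma generated_subring : subring_closed generated_pred.
Proof.
split=> [|a b|a b].
- by apply/asboolP; rewrite -(rmorph1 iota); apply: generated_const.
- move=> /asboolP ga /asboolP gb; apply/asboolP; apply: generated_add => //.
  rewrite -mulN1r; apply: generated_mul => //.
  by rewrite -(rmorph1 iota) -rmorphN; apply: generated_const.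
- by move=> /asboolP ga /asboolP gb; apply/asboolP; apply: generated_mul.
Qed.

HB.instance Definition _ :=
  GRing.isSubringClosed.Build A generated_pred generated_subring.
HB.instance Definition _ := [SubChoice_isSubComNzRing of subalg by <:].

Definition subalg_const (c : C) : subalg :=
  Subalg (introT (asboolP _) (generated_const c)).

Lemma generated_morph (phi : {rmorphism A -> A}) :
  (forall c, phi (iota c) = iota c) ->
  (forall a, S a -> phi a \in generated_pred) ->
  forall a, a \in generated_pred -> phi a \in generated_pred.
Proof.
move=> phiC phiS x /asboolP; elim=> [c|a Sa|a b _ ga _ gb|a b _ ga _ gb].
- by rewrite phiC; apply/asboolP/generated_const.
- exact: phiS.
- by rewrite rmorphD rpredD.
- by rewrite rmorphM rpredM.
Qed.

End GeneratedSubalgebra.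

Section Clusters.
Variables (V : finType) (K : fieldType).

(* exch u v is the number of arrows u -> v minus the number of arrows v -> u
   (quivers here have no loops or 2-cycles). *)
Record seed := Seed { cvar : V -> K; exch : V -> V -> int }.

Definition mutate (v : V) (s : seed) : seed :=
  let x := cvar s in
  let b := exch s in
  Seed
    (fun u => if u == v then
        (\prod_(w | 0 < b w v) x w ^+ `|b w v|%N
         + \prod_(w | b w v < 0) x w ^+ `|b w v|%N) / x v
      else x u)
    (fun u w => if (u == v) || (w == v) then - b u w
      else b u w + Num.max 0 (b u v) * Num.max 0 (b v w)
                 - Num.max 0 (- b u v) * Num.max 0 (- b v w)).

Inductive mutation_equivalent (s : seed) : seed -> Prop :=
| mutation_refl : mutation_equivalent s s
| mutation_step t v :
    mutation_equivalent s t -> mutation_equivalent s (mutate v t).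

Definition cluster_variable (s : seed) (y : K) : Prop :=
  exists2 t, mutation_equivalent s t & exists v, y = cvar t v.

End Clusters.

Section Twist.
Variables (A : comNzRingType) (k n : nat).

(* u 0, ..., u (k - 2) are the first k - 1 columns; v is the last one. *)
Definition det_last (u : nat -> 'cV[A]_k) (v : 'cV[A]_k) : A :=
  \det (\matrix_(s < k, c < k) if (c < k.-1)%N then u c s 0 else v s 0).

Definition cross (u : nat -> 'cV[A]_k) : 'cV[A]_k :=
  \col_r det_last u (delta_mx r 0).

(* i is the 1-based label of a column. *)
Definition twist_sign (i : nat) : A :=
  if (i < k)%N then (-1) ^+ (i * (k - i)) else 1.

(* Columns are indexed from 0 here, and [ord_pred] is the shift
   sigma : i |-> i - 1 mod n. *)
Definition twist_mx (p : 'M[A]_(k, n)) : 'M[A]_(k, n) :=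
  \matrix_(r, i) (twist_sign i.+1 *
    cross (fun c => col (iter (k.-1 - c) (@ord_pred n) i) p) r 0).

Definition ksubset := {I : {set 'I_n} | #|I| == k}.

(* enum_val enumerates a set of ordinals in increasing order. *)
Definition ksubset_nth (I : ksubset) (c : 'I_k) : 'I_n :=
  enum_val (cast_ord (esym (eqP (valP I))) c).

Definition minor (p : 'M[A]_(k, n)) (I : ksubset) : A :=
  \det (colsub (ksubset_nth I) p).

End Twist.

Lemma det_lastE (A : comNzRingType) (k : nat) (u : nat -> 'cV[A]_k)
    (v : 'cV[A]_k) : (0 < k)%N ->
  det_last u v = \sum_r cross u r 0 * v r 0.
Proof.
case: k u v => // k u v _; rewrite /det_last.
rewrite (expand_det_col _ ord_max); apply: eq_bigr => r _.
rewrite !mxE /= ltnn mulrC; congr (_ * _).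
rewrite /det_last (expand_det_col _ ord_max) (bigD1 r) //= big1 => [|s ns].
  rewrite addr0 !mxE /= ltnn !eqxx mul1r /cofactor; congr (_ * \det _).
  apply/matrixP=> s c; rewrite !mxE /= /bump.
  by have := ltn_ord c; rewrite ltnNge => /negbTE ->; rewrite add0n ltn_ord.
by rewrite !mxE /= ltnn (negbTE ns) mul0r.
Qed.

Lemma crossP (A : comNzRingType) (k : nat) (u : nat -> 'cV[A]_k)
    (w : 'cV[A]_k) : (0 < k)%N ->
  (forall v : 'cV[A]_k, w^T *m v = (det_last u v)%:M) <-> w = cross u.
Proof.
move=> k0; split=> [h|-> v].
  apply/colP=> r; have := congr1 (fun M : 'M_1 => M 0 0) (h (delta_mx r 0)).
  rewrite mxE (bigD1 r) //= big1 => [|s ns].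
    by rewrite addr0 !mxE !eqxx mulr1.
  by rewrite !mxE (negbTE ns) mulr0.
apply/matrixP=> a b; rewrite !ord1 !mxE eqxx mulr1n det_lastE //.
by apply: eq_bigr => r _; rewrite mxE.
Qed.

Lemma det_last_repeat (A : comNzRingType) (k : nat) (u : nat -> 'cV[A]_k)
    (a : nat) : (a < k.-1)%N -> det_last u (u a) = 0.
Proof.
case: k u => // k u /= ak.
rewrite /det_last -det_tr (determinant_alternate (i1 := inord a) (i2 := ord_max)) //.
  by rewrite -val_eqE /= inordK ?(ltn_eqF ak) //; exact: ltnW.
by move=> c; rewrite !mxE /= ltnn inordK ?ak // ltnW.
Qed.

Lemma det_twist (A : idomainType) (k n : nat) (p : 'M[A]_(k.+1, n))
    (h : 'I_k.+1 -> 'I_n) :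
  let u i c := col (iter (k - c) (@ord_pred n) i) p in
  let e i := twist_sign A k.+1 i.+1 in
  \det (colsub h (twist_mx p)) = 0 \/
  \det (colsub h (twist_mx p)) = e (h ord_max) *
    \det (\matrix_(a < k, b < k) (e (h (lift ord_max b)) *
       det_last (u (h (lift ord_max b))) (u (h ord_max) a))).
Proof.
move=> u e; set W := colsub h _; set i0 := h ord_max.
have We r b : W r b = e (h b) * cross (u (h b)) r 0 by rewrite !mxE.
have [/eqP u0|] := boolP (cross (u i0) == 0).
  left; rewrite (expand_det_col _ ord_max) big1 // => r _.
  by rewrite We -/i0 u0 mxE mulr0 mul0r.
move=> un0; right.
have [i ui] : exists i, cross (u i0) i 0 != 0.
  apply/existsP; apply: contraNT un0 => /existsPn h0; apply/eqP/colP=> i.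
  by rewrite [RHS]mxE; move/negPn/eqP: (h0 i).
pose M : 'M[A]_k.+1 := \matrix_(s, c)
  if (c < k)%N then u i0 c s 0 else (delta_mx i 0 : 'cV_k.+1) s 0.
have dM : \det M = cross (u i0) i 0 by rewrite [RHS]mxE.
have dM0 : \det M != 0 by rewrite dM.
apply: (mulfI dM0); rewrite -{1}det_tr -det_mulmx.
have NE a b : (M^T *m W) a b = e (h b) * det_last (u (h b)) (col a M).
  rewrite det_lastE // mulr_sumr mxE; apply: eq_bigr => s _.
  by rewrite We mxE [col a M s 0]mxE mulrCA [M s a * _]mulrC.
have colM (a : 'I_k) : col (lift ord_max a) M = u i0 a.
  by apply/colP=> s; rewrite [LHS]mxE [LHS]mxE lift_max ltn_ord.
have colMl : col ord_max M = delta_mx i 0.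
  by apply/colP=> s; rewrite [LHS]mxE [LHS]mxE /= ltnn.
rewrite (expand_det_col _ ord_max) (bigD1 ord_max) //= big1 => [|a na].
  rewrite addr0 NE -/i0 colMl dM /cofactor -signr_odd oddD addbb expr0 mul1r.
  rewrite [in RHS]mulrCA mulrA -dM.
  congr (_ * _); congr (determinant _); apply/matrixP=> a b.
  by rewrite [LHS]mxE [LHS]mxE NE colM [RHS]mxE.
case: (unliftP ord_max a) na => [j ->|->]; last by rewrite eqxx.
by move=> _; rewrite NE colM det_last_repeat ?mulr0 ?mul0r //= ltn_ord.
Qed.

Lemma det_last_colsub (A : comNzRingType) (k n : nat) (p : 'M[A]_(k, n))
    (h : nat -> 'I_n) (j : 'I_n) :
  det_last (fun c => col (h c) p) (col j p) =
  \det (colsub (fun c : 'I_k => if (c < k.-1)%N then h c else j) p).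
Proof.
congr (\det _); apply/matrixP=> s c.
by rewrite !mxE; case: ifP => _; rewrite ?mxE.
Qed.

Lemma map_twist_mx (A B : comNzRingType) (phi : {rmorphism A -> B}) (k n : nat)
    (p : 'M[A]_(k, n)) :
  map_mx phi (twist_mx p) = twist_mx (map_mx phi p).
Proof.
apply/matrixP=> r i; rewrite !mxE rmorphM /=; congr (_ * _).
  by rewrite /twist_sign; case: ifP; rewrite ?rmorphXn ?rmorphN ?rmorph1.
rewrite /det_last -det_map_mx; congr (\det _); apply/matrixP=> s c.
by rewrite !mxE; case: ifP => _; rewrite ?mxE ?rmorph_nat.
Qed.

Lemma map_minor (A B : comNzRingType) (phi : {rmorphism A -> B}) (k n : nat)
    (p : 'M[A]_(k, n)) (I : ksubset k n) :
  phi (minor p I) = minor (map_mx phi p) I.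
Proof. by rewrite /minor -det_map_mx map_mxsub. Qed.

Section Grassmannian.
Variables (R : realType) (k n : nat).

Definition coord_ring := {mpoly R[i][k * n]}.
Definition generic_mx : 'M[coord_ring]_(k, n) :=
  \matrix_(r, c) 'X_(mxvec_index r c).

Definition is_plucker (f : coord_ring) : Prop :=
  exists I : ksubset k n, f = minor generic_mx I.

Definition Gr_ring := subalg (@mpolyC (k * n) R[i]) is_plucker.

Lemma plucker_subproof (I : ksubset k n) :
  minor generic_mx I \in generated_pred (@mpolyC (k * n) R[i]) is_plucker.
Proof. by apply/asboolP; apply: generated_gen; exists I. Qed.

Definition plucker (I : ksubset k n) : Gr_ring := Subalg (plucker_subproof I).

(* f |-> (p |-> f (twist_mx p)) on C[M_{k,n}]; see twist_polyE. *)
Definition twist_poly (f : coord_ring) : coord_ring :=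
  f \mPo [tuple mxvec (twist_mx generic_mx) 0 m | m < k * n].

Lemma det_colsub_generated (h : 'I_k -> 'I_n) :
  \det (colsub h generic_mx)
    \in generated_pred (@mpolyC (k * n) R[i]) is_plucker.
Proof.
have [/injectiveP hi|/injectivePn [a [b ab hab]]] := boolP (injectiveb h).
  have cI : #|[set h c | c : 'I_k]| == k by rewrite card_imset // card_ord.
  pose I : ksubset k n := exist _ [set h c | c : 'I_k] cI.
  have hI c : h c \in sval I by apply: imset_f.
  pose s0 (c : 'I_k) : 'I_k :=
    cast_ord (eqP (valP I)) (enum_rank_in (hI c) (h c)).
  have s0K c : ksubset_nth I (s0 c) = h c.
    by rewrite /ksubset_nth /s0 cast_ordK enum_rankK_in.
  have s0i : injective s0 by move=> c d e; apply: hi; rewrite -!s0K e.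
  have -> : colsub h generic_mx =
      col_perm (perm s0i) (colsub (ksubset_nth I) generic_mx).
    by apply/matrixP=> r c; rewrite [RHS]mxE [RHS]mxE permE s0K mxE.
  rewrite col_permE det_mulmx det_perm rpredM ?rpredX ?rpredN1 //.
  exact: plucker_subproof.
rewrite -det_tr (determinant_alternate ab) ?rpred0 // => c.
by rewrite !mxE hab.
Qed.

Lemma det_last_generated (h : nat -> 'I_n) (j : 'I_n) :
  det_last (fun c => col (h c) generic_mx) (col j generic_mx)
    \in generated_pred (@mpolyC (k * n) R[i]) is_plucker.
Proof.
by rewrite det_last_colsub; apply: det_colsub_generated.
Qed.

Lemma twist_polyE (f : coord_ring) (p : 'M[R[i]]_(k, n)) :
  (twist_poly f).@[mxvec p 0] = f.@[mxvec (twist_mx p) 0].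
Proof.
have gp : map_mx (meval (mxvec p 0)) generic_mx = p.
  by apply/matrixP=> r c; rewrite [LHS]mxE [X in meval _ X]mxE mevalXU mxvecE.
rewrite /twist_poly comp_mpoly_meval; apply: meval_eq => m.
rewrite tnth_mktuple -{2}gp -map_twist_mx.
by case/mxvec_indexP: m => r c; rewrite !mxvecE [RHS]mxE.
Qed.

Lemma twist_poly_minor (I : ksubset k n) :
  twist_poly (minor generic_mx I) = minor (twist_mx generic_mx) I.
Proof.
rewrite /twist_poly map_minor; congr (minor _ I); apply/matrixP=> r c.
rewrite [LHS]mxE.
have -> : generic_mx r c = 'X_(mxvec_index r c) by rewrite mxE.
apply: etrans; first exact: comp_mpolyXU.
by rewrite -tnth_nth tnth_mktuple mxvecE.
Qed.

End Grassmannian.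

Lemma det_twist_generated (R : realType) (k n : nat) (h : 'I_k -> 'I_n) :
  \det (colsub h (twist_mx (generic_mx R k n)))
    \in generated_pred (@mpolyC (k * n) R[i]) (@is_plucker R k n).
Proof.
case: k h => [|k] h; first by rewrite det_mx00 rpred1.
have sgn i : twist_sign (coord_ring R k.+1 n) k.+1 i
    \in generated_pred (@mpolyC (k.+1 * n) R[i]) (@is_plucker R k.+1 n).
  by rewrite /twist_sign; case: ifP => _; rewrite ?rpred1 // rpredX ?rpredN1.
have [->|->] := det_twist (generic_mx R k.+1 n) h; first exact: rpred0.
apply: rpredM => //; apply: rpred_sum => s _; apply: rpredM.
  by rewrite rpredX ?rpredN1.
apply: rpred_prod => a _; rewrite mxE; apply: rpredM => //.
exact: (@det_last_generated R k.+1 n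
  (fun c => iter (k - c) (@ord_pred n) _)).
Qed.

Section GrassmannianTwist.
Variables (R : realType) (k n : nat).

Lemma twist_subproof (f : Gr_ring R k n) : twist_poly (subalg_val f)
  \in generated_pred (@mpolyC (k * n) R[i]) (@is_plucker R k n).
Proof.
have phiS a : is_plucker a -> twist_poly a
    \in generated_pred (@mpolyC (k * n) R[i]) (@is_plucker R k n).
  by case=> I ->; rewrite twist_poly_minor; apply: det_twist_generated.
apply: (generated_morph (phi := comp_mpoly _)) => [c|a Sa|].
- exact: comp_mpolyC.
- exact: phiS.
by case: f.
Qed.

Definition twist (f : Gr_ring R k n) : Gr_ring R k n :=
  Subalg (twist_subproof f).

Lemma twist_is_zmod_morphism : zmod_morphism twist.
Proof. by move=> f g; apply/val_inj; rewrite /= /twist_poly rmorphB. Qed.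

Lemma twist_is_monoid_morphism : monoid_morphism twist.
Proof.
by split=> [|f g]; apply/val_inj; rewrite /= /twist_poly ?rmorph1 ?rmorphM.
Qed.

HB.instance Definition _ := GRing.isZmodMorphism.Build
  (Gr_ring R k n) (Gr_ring R k n) twist twist_is_zmod_morphism.
HB.instance Definition _ := GRing.isMonoidMorphism.Build
  (Gr_ring R k n) (Gr_ring R k n) twist twist_is_monoid_morphism.

End GrassmannianTwist.

Section Coefficients.
Variables (k n : nat).

(* {sigma^(k-1)(i), ..., sigma(i), i} *)
Definition coef_set (i : 'I_n) : {set 'I_n} :=
  [set iter r (@ord_pred n) i | r : 'I_k].

(* M_{k,n}(i,j) = {1, ..., i} U {i+j+1, ..., j+k}, in 1-based labels. *)
Definition rect_set (i j : nat) : {set 'I_n} :=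
  [set c : 'I_n | (c.+1 <= i) || (i + j + 1 <= c.+1 <= j + k)]%N.

Lemma card_coef_set (i : 'I_n) : (k <= n)%N -> #|coef_set i| = k.
Proof.
move=> kn; rewrite card_imset ?card_ord // => r s.
have iterE (m : 'I_k) : (iter m (@ord_pred n) i + m = i %[mod n])%N.
  elim: (val m) => [|d IH]; first by rewrite addn0.
  set j := iter d _ i in IH *; rewrite iterS -/j /=.
  have nj : (0 < j + n)%N by rewrite addn_gt0 (leq_trans _ (ltn_ord i)) ?orbT.
  by rewrite modnDml -addSnnS prednK // addnAC modnDr.
move=> rs; have := iterE s; rewrite -rs -(iterE r) => /eqP.
rewrite eqn_modDl !modn_small ?(leq_trans (ltn_ord _) kn) // => /eqP sr.
exact/esym/val_inj.
Qed.

Lemma card_rect_set (i j : nat) :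
  (i <= k)%N -> (j + k <= n)%N -> #|rect_set i j| = k.
Proof.
move=> ik jkn.
pose g (c : nat) := if (c < i)%N then c else (c + j)%N.
have fP (c : 'I_k) : (g c < n)%N.
  by have := ltn_ord c; rewrite /g; case: ifP => _; lia.
pose f c := Ordinal (fP c).
have fi : injective f.
  move=> c d /(congr1 val) /= e; apply/val_inj; move: e => /=.
  by rewrite /g; case: ltnP => ?; case: ltnP => ? ?; lia.
rewrite -[RHS]card_ord -(card_imset _ fi); congr #|pred_of_set _|.
apply/setP=> c; rewrite inE; apply/idP/imsetP => [|[d _ ->] /=].
  rewrite /g; case: (ltnP c i) => [ci _|ic /= /andP[ijc cjk]].
    by exists (Ordinal (leq_trans ci ik)); last by apply/val_inj; rewrite /= /g ci.
  have cjk' : (c - j < k)%N by lia.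
  exists (Ordinal cjk') => //; apply/val_inj; rewrite /= /g.
  by case: ltnP => ?; lia.
by have dk := ltn_ord d; rewrite /g; case: (ltnP d i) => ?; lia.
Qed.

End Coefficients.

Section Projection.
Variables (R : realType) (k n : nat).

Definition vertex (a : nat * nat) : bool :=
  (a == (0, 0)%N) || [&& a.1 <= k.-1, 1 <= a.2 & a.2 <= n - k]%N.

Definition frozen (a : nat * nat) : bool :=
  ~~ [&& 1 <= a.1, a.1 <= k.-1, 1 <= a.2 & a.2 <= (n - k).-1]%N.

(* The arrows a -> b of the rectangles quiver, frozen vertices included. *)
Definition arrow (a b : nat * nat) : bool :=
  (a == (0, 0)%N) && (b == (k.-1, 1)%N) ||
  [&& vertex a, vertex b, a != (0, 0)%N, b != (0, 0)%N,
      ~~ (frozen a && frozen b) &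
      [|| a == (b.1.+1, b.2), b == (a.1, a.2.+1)
        | (a.2 == b.2.+1) && (b.1 == a.1.+1)]].

(* The non-frozen vertices; (i, j) stands for the vertex (i + 1, j + 1). *)
Definition mutable : finType := ('I_k.-1 * 'I_(n - k).-1)%type.
Definition mutable_vertex (v : mutable) : nat * nat := (v.1.+1, v.2.+1)%N.

(* The field C(x) of rational functions in the initial cluster. *)
Definition rat_field := {fraction {mpoly R[i][k.-1 * (n - k).-1]}}.

Definition initial_var (v : mutable) : rat_field :=
  tofrac 'X_(mxvec_index v.1 v.2).

Definition initial_seed : seed mutable rat_field :=
  Seed initial_var
    (fun u v => (arrow (mutable_vertex u) (mutable_vertex v))%:Z
              - (arrow (mutable_vertex v) (mutable_vertex u))%:Z).

(* C[Gr_{k,n}]_1. If k = 1 or k = n - 1 there are no mutable vertices, and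
   this is the field of constants C. *)
Definition Gr_ring1 :=
  subalg (@tofrac {mpoly R[i][k.-1 * (n - k).-1]} \o
            @mpolyC (k.-1 * (n - k).-1) R[i])
         (cluster_variable initial_seed).

Record is_projection (pi : {rmorphism Gr_ring R k n -> Gr_ring1}) : Prop :=
  IsProjection {
    projection_const : forall c : R[i],
      pi (subalg_const _ _ c) = subalg_const _ _ c;
    projection_coef : forall (i : 'I_n) (I : ksubset k n),
      val I = coef_set k i -> pi (plucker R I) = 1;
    projection_cluster : forall (v : mutable) (I : ksubset k n),
      val I = rect_set k n (mutable_vertex v).1 (mutable_vertex v).2 ->
      val (pi (plucker R I)) = initial_var v;
    projection_surj : forall y, exists f, pi f = y
  }.

(* phi1 and phi2 range over endomorphisms; morphism structure is not needed
   to compare them. *)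
Definition equal_up_to_coefficients
    (pi : {rmorphism Gr_ring R k n -> Gr_ring1})
    (phi1 phi2 : Gr_ring R k n -> Gr_ring R k n) : Prop :=
  pi \o phi1 =1 pi \o phi2.

End Projection.

(* Main.v *)
Require Import Defs.
From HB Require Import structures.
From mathcomp Require Import all_boot all_order all_algebra.
From mathcomp Require Import reals boolp complex mpoly zify ring.

(** The square of the twist is, column by column, a cyclic shift.

    Write q_j for the j-th column of the twist of p, so that q_j . v is, up to
    a sign, det(p_{j-k+1}, ..., p_{j-1}, v).  Then q_j is orthogonal to
    p_{j-k+1}, ..., p_{j-1}, and the sign is chosen so that q_j . p_j is exactly
    the coefficient [j], also when the window j-k+1, ..., j wraps around.  The
    matrix of the products p_a . q_b, with a and b in one window, is therefore
    triangular with coefficients on its diagonal.  Taking determinants gives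
    two facts, in which a nonzero window determinant has been cancelled:

    - the twist of a coefficient is a product of k - 1 coefficients
      ([coefficient_twist]);
    - p_{i-k} is orthogonal to the k - 1 vectors q_b that define the i-th column
      of the double twist, so this column is a multiple of p_{i-k}; when k >= 2
      the factor is a sign times a product of k - 2 coefficients
      ([twist_twist]).

    By the first fact, a product of coefficients stays a product of coefficients
    under all powers of the twist, hence pi sends all its twists to 1: this is
    [coef_trivial].  By the second one, the (2m)-th power of the twist sends p_i
    to a signed product of coefficients times p_{i-mk} ([iter_twist_generic]).
    For m = n the index is i again.  Only the sign is left.  A step i -> i-k
    contributes (-1)^(k-1), and once more (-1)^(k-1) if it wraps around
    ([twist_sign_wrap]); in n steps the index winds around exactly k times.
    So each column acquires the sign (-1)^((k-1)(n+k)), and a minor, which has k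
    columns, acquires (-1)^(k(k-1)(n+k)) = 1.  The Pluecker coordinates and the
    constants generate the ring, which proves the claim.

    For k = 1 the double twist is not a shift, but every Pluecker coordinate is
    a coefficient and is twisted to 1. *)

Set Implicit Arguments.
Unset Strict Implicit.
Unset Printing Implicit Defensive.

Import Order.TTheory GRing.Theory Num.Theory.
Local Open Scope ring_scope.

(** * Cyclic shifts of indices and of columns *)

Lemma val_iter_ord_pred n (i : 'I_n) m : (m <= n)%N ->
  val (iter m (@ord_pred n) i) = (if m <= i then i - m else i + n - m)%N.
Proof.
have := ltn_ord i; elim: m => [|m IH] ilt mn; first by rewrite subn0.
rewrite iterS /= (IH ilt (ltnW mn)).
have [mi|mi|mi] := ltngtP m i.
- have -> : ((i - m + n).-1 = (i - m.+1) + n)%N by lia.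
  by rewrite modnDr modn_small //; lia.
- have -> : ((i + n - m + n).-1 = (i + n - m.+1) + n)%N by lia.
  by rewrite modnDr modn_small //; lia.
- by rewrite modn_small; lia.
Qed.

Lemma iter_ord_pred_inj n (i : 'I_n) m1 m2 : (m1 < n)%N -> (m2 < n)%N ->
  iter m1 (@ord_pred n) i = iter m2 (@ord_pred n) i -> m1 = m2.
Proof.
move=> h1 h2 /(congr1 val); rewrite !val_iter_ord_pred; try exact: ltnW.
by have := ltn_ord i; do 2 case: ifP; lia.
Qed.

(** Laplace expansion along the column that moves from one end to the other:
    the complementary minors agree, and the cofactor signs differ by (-1)^k. *)
Lemma det_colsub_ordS (A : comNzRingType) k (M : 'M[A]_k.+1) :
  \det (colsub (@ordS k.+1) M) = (-1) ^+ k * \det M.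
Proof.
rewrite (expand_det_col _ ord_max) (expand_det_col M ord0) mulr_sumr.
apply: eq_bigr => r _; rewrite /cofactor addn0 exprD !mxE.
have -> : ordS (ord_max : 'I_k.+1) = ord0.
  by apply/val_inj; rewrite /= modnn.
rewrite [RHS]mulrCA; congr (_ * _); rewrite mulrA [(-1) ^+ k * _]mulrC.
congr (_ * \det _); apply/matrixP=> a b; rewrite !mxE; congr (M _ _).
apply/val_inj; rewrite /= /bump /= leqNgt ltn_ord add0n add1n modn_small //.
by rewrite ltnS.
Qed.

Lemma det_colsub_iter_ordS (A : comNzRingType) k m (M : 'M[A]_k.+1) :
  \det (colsub (iter m (@ordS k.+1)) M) = (-1) ^+ (m * k) * \det M.
Proof.
elim: m => [|m IH].
  by rewrite mul0n mul1r; congr determinant; apply/matrixP=> r c; rewrite mxE.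
have -> : colsub (iter m.+1 (@ordS k.+1)) M =
    colsub (@ordS k.+1) (colsub (iter m (@ordS k.+1)) M).
  by apply/matrixP=> r c; rewrite !mxE iterSr.
by rewrite det_colsub_ordS IH mulrA -exprD mulSn.
Qed.

(** * The triangular pairing of a matrix with its twist *)

Section Window.
Variables (A : comNzRingType) (k n : nat).

(** The columns j-k, ..., j in cyclic order, which is not the increasing order
    of the labels when the window wraps around. *)
Definition window (j : 'I_n) (c : 'I_k.+1) : 'I_n :=
  iter (k - c) (@ord_pred n) j.

(** The sign turns the determinant of the window into the minor whose columns
    are in increasing order, see [minor_coef_set]. *)
Definition coefficient (p : 'M[A]_(k.+1, n)) (j : 'I_n) : A :=
  twist_sign A k.+1 j.+1 * \det (colsub (window j) p).

Lemma twist_sign_sqr i : twist_sign A k.+1 i * twist_sign A k.+1 i = 1.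
Proof.
by rewrite /twist_sign; case: ifP; rewrite ?mulr1 // -expr2 sqrr_sign.
Qed.

Lemma twist_pairingE (p : 'M[A]_(k.+1, n)) i j :
  \sum_r p r i * twist_mx p r j = twist_sign A k.+1 j.+1 *
    det_last (fun c => col (iter (k - c) (@ord_pred n) j) p) (col i p).
Proof.
rewrite det_lastE // mulr_sumr; apply: eq_bigr => r _.
by rewrite [twist_mx p r j]mxE [col i p r 0]mxE mulrC mulrA.
Qed.

(** Column d steps before j is among the factors of the cross product that
    defines column j of the twist. *)
Lemma twist_pairing0 (p : 'M[A]_(k.+1, n)) d i j : (0 < d <= k)%N ->
  i = iter d (@ord_pred n) j -> \sum_r p r i * twist_mx p r j = 0.
Proof.
move=> dk ->; rewrite twist_pairingE.
pose u c := col (iter (k - c) (@ord_pred n) j) p.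
have -> : col (iter d (@ord_pred n) j) p = u (k - d)%N.
  by rewrite /u subKn; last by case/andP: dk.
by rewrite det_last_repeat ?mulr0 //=; lia.
Qed.

(** This identity is what the signs in the definition of the twist are for. *)
Lemma twist_pairing_diag (p : 'M[A]_(k.+1, n)) j :
  \sum_r p r j * twist_mx p r j = coefficient p j.
Proof.
rewrite twist_pairingE /coefficient.
rewrite (det_last_colsub p (fun c => iter (k - c) (@ord_pred n) j) j).
congr (_ * \det _); apply/matrixP=> r c; rewrite !mxE; congr (p r _).
rewrite /window /=; case: ltnP => // kc.
by have -> : (k - c = 0)%N by have := ltn_ord c; lia.
Qed.

(** The left-hand side is the determinant of the Gram matrix of the window of p
    and that of its twist, which is triangular by [twist_pairing0]. *)
Lemma det_window_twist (p : 'M[A]_(k.+1, n)) j :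
  \det (colsub (window j) p) * \det (colsub (window j) (twist_mx p)) =
  \prod_c coefficient p (window j c).
Proof.
rewrite -[\det (colsub _ p)]det_tr -det_mulmx det_trig.
  apply: eq_bigr => c _; rewrite -twist_pairing_diag mxE.
  by apply: eq_bigr => r _; rewrite !mxE.
apply/is_trig_mxP => a b ab; rewrite mxE.
rewrite -[RHS](@twist_pairing0 p (b - a) (window j a) (window j b)).
- by apply: eq_bigr => r _; rewrite !mxE.
- by have := ltn_ord b; lia.
- by rewrite /window -iterD; congr (iter _ _ _); have := ltn_ord b; lia.
Qed.
End Window.

Section TwistDomain.
Variables (A : idomainType) (k n : nat) (p : 'M[A]_(k.+1, n)).

(** [det_window_twist], divided by the window determinant, which up to sign is
    the last factor of the product. *)
Lemma coefficient_twist j : \det (colsub (window j) p) != 0 ->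
  coefficient (twist_mx p) j =
  \prod_(c < k) coefficient p (window j (widen_ord (leqnSn k) c)).
Proof.
move=> nz; apply: (mulfI nz); rewrite /coefficient mulrCA det_window_twist.
rewrite big_ord_recr /= {2}/coefficient.
have -> : window j (ord_max : 'I_k.+1) = j by rewrite /window /= subnn.
set P := \prod_(_ < _) _; set e := twist_sign _ _ _; set D := \det _.
have -> : e * (P * (e * D)) = e * e * (D * P) by ring.
by rewrite twist_sign_sqr mul1r.
Qed.
End TwistDomain.

Section TwistTwist.
Variables (A : idomainType) (k n : nat) (p : 'M[A]_(k.+2, n)).

(** Pair the window p_{i-k'}, ..., p_{i-1}, of length k' = k+2, with the matrix U
    whose columns are the r-th basis vector followed by the k+1 columns of the
    twist that define column i of the double twist.  The products form a
    triangular matrix whose first diagonal entry is the r-th coordinate of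
    p_{i-k'}.  Rotating U by one column turns its determinant into the r-th
    coordinate of the cross product, and the window determinant cancels against
    the last diagonal entry. *)
Lemma twist_twist i r :
  \det (colsub (window (ord_pred i)) p) != 0 ->
  twist_mx (twist_mx p) r i =
  (-1) ^+ k.+1 * twist_sign A k.+2 i.+1
    * twist_sign A k.+2 (ord_pred i).+1
    * (\prod_(c < k) coefficient p (iter (k.+1 - c) (@ord_pred n) i))
    * p r (iter k.+2 (@ord_pred n) i).
Proof.
move=> nz.
pose q := twist_mx p.
pose U : 'M[A]_k.+2 := \matrix_(s, c)
  if c == ord0 then (s == r)%:R else q s (iter (k.+2 - c) (@ord_pred n) i).
have windowE (c : 'I_k.+2) :
    window (ord_pred i) c = iter (k.+2 - c) (@ord_pred n) i.
  by rewrite /window -iterSr -subSn // -ltnS.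
have UE s c : c != ord0 -> U s c = q s (window (ord_pred i) c).
  by move=> c0; rewrite [LHS]mxE (negbTE c0) windowE.
have detU : \det (colsub (window (ord_pred i)) p) * \det U =
    p r (iter k.+2 (@ord_pred n) i) *
    \prod_(c < k.+1) coefficient p (window (ord_pred i) (lift ord0 c)).
  rewrite -[\det (colsub _ p)]det_tr -det_mulmx det_trig.
    rewrite big_ord_recl /=; congr (_ * _).
      rewrite mxE (bigD1 r) //= big1 ?addr0 => [|s ns].
        by rewrite !mxE !eqxx mulr1 windowE subn0.
      by rewrite !mxE (negbTE ns) /= mulr0.
    apply: eq_bigr => c _; rewrite -twist_pairing_diag mxE.
    by apply: eq_bigr => s _; rewrite UE //; congr (_ * _); rewrite !mxE.
  apply/is_trig_mxP => a b ab; rewrite mxE.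
  have b0 : b != ord0 by rewrite -val_eqE /=; lia.
  rewrite -[RHS](@twist_pairing0 _ _ _ p (b - a) (window (ord_pred i) a)
     (window (ord_pred i) b)).
  - by apply: eq_bigr => s _; rewrite UE //; congr (_ * _); rewrite !mxE.
  - by have := ltn_ord b; lia.
  - by rewrite !windowE -iterD; congr (iter _ _ _); have := ltn_ord b; lia.
have crossE : twist_mx q r i =
    twist_sign A k.+2 i.+1 * ((-1) ^+ k.+1 * \det U).
  rewrite [LHS]mxE [cross _ _ _]mxE; congr (_ * _); rewrite -det_colsub_ordS.
  congr (\det _); apply/matrixP=> s c; rewrite [LHS]mxE [RHS]mxE.
  case: ltnP => ck.
    rewrite UE ?windowE; last by rewrite -val_eqE /= modn_small.
    by rewrite [LHS]mxE /= modn_small.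
  have -> : ordS c = ord0.
    have -> : c = ord_max by apply/val_inj; have := ltn_ord c; rewrite /=; lia.
    by apply/val_inj; rewrite /= modnn.
  by rewrite !mxE eqxx andbT.
rewrite crossE; apply: (mulfI nz).
rewrite mulrCA [_ * (_ * \det U)]mulrCA detU big_ord_recr /=.
have -> : window (ord_pred i) (lift ord0 (ord_max : 'I_k.+1)) = ord_pred i.
  by rewrite windowE /= /bump add1n subSnn.
have -> : \prod_(c < k) coefficient p (window (ord_pred i)
      (lift ord0 (widen_ord (leqnSn k) c)))
    = \prod_(c < k) coefficient p (iter (k.+1 - c) (@ord_pred n) i).
  by apply: eq_bigr => c _; rewrite windowE.
by rewrite {2}/coefficient; ring.
Qed.
End TwistTwist.

(** * Coefficients as Pluecker coordinates *)

Lemma sorted_val_enum n (I : {set 'I_n}) : sorted ltn (map val (enum I)).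
Proof.
rewrite [enum _]/(enum_mem _) /enum_mem -enumT.
have : subseq [seq val i | i <- [seq x <- enum 'I_n | x \in I]] (iota 0 n).
  by rewrite -val_enum_ord map_subseq // filter_subseq.
move=> h; apply: subseq_sorted h _; first exact: ltn_trans.
exact: iota_ltn_sorted.
Qed.

Lemma ksubset_nth_increasing k n (I : ksubset k n) (h : 'I_k -> 'I_n) :
  {homo h : a b / (a < b)%N} -> (forall c, h c \in val I) -> ksubset_nth I =1 h.
Proof.
move=> hh hI c.
have es : map val (enum (val I)) = map (val \o h) (enum 'I_k).
  have hs : sorted ltn (map (val \o h) (enum 'I_k)).
    have := iota_ltn_sorted 0 k; rewrite -val_enum_ord !sorted_map.
    by apply: sub_sorted => a b; exact: hh.
  have uh : uniq (map (val \o h) (enum 'I_k)).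
    by apply: sorted_uniq hs; [exact: ltn_trans|exact: ltnn].
  apply/esym/(irr_sorted_eq _ _ hs (sorted_val_enum _)).
  - exact: ltn_trans.
  - exact: ltnn.
  have sub : {subset map (val \o h) (enum 'I_k) <= map val (enum (val I))}.
    by move=> x /mapP [a _ ->]; rewrite /= map_f // mem_enum.
  apply: (uniq_min_size uh sub _).2.
  by rewrite 2!size_map size_enum_ord -cardE (eqP (valP I)).
apply/val_inj; rewrite /ksubset_nth (enum_val_nth (h c)) /=.
have ci : (c < size (enum (val I)))%N by rewrite -cardE (eqP (valP I)).
rewrite -(nth_map (h c) (val (h c))) // es.
by rewrite (nth_map c) /= ?nth_ord_enum // -cardE card_ord.
Qed.

Lemma val_iter_ordS k m (c : 'I_k.+1) :
  val (iter m (@ordS k.+1) c) = ((c + m) %% k.+1)%N.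
Proof.
elim: m => [|m IH]; first by rewrite addn0 modn_small.
by rewrite iterS /= IH -addn1 modnDml addn1 addnS.
Qed.

(** If k > j, the first k - j entries of the window wrap around; rotating it by
    k - j steps puts the labels in increasing order.  The sign of this rotation
    is (-1)^((k-j)k), which agrees with the (-1)^((j+1)(k-j)) of the twist since
    (k-j)(k-j-1) is even. *)
Lemma minor_coef_set (A : comNzRingType) k n (p : 'M[A]_(k.+1, n)) j
    (I : ksubset k.+1 n) :
  (k < n)%N -> val I = coef_set k.+1 j -> minor p I = coefficient p j.
Proof.
move=> kn eI.
(* The truncated difference k - j is 0 when the window does not wrap. *)
have enumI : ksubset_nth I =1 window j \o iter (k - j) (@ordS k.+1).
  apply: ksubset_nth_increasing => [a b ab|c].
    rewrite /= /window !val_iter_ord_pred; try lia.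
    rewrite !val_iter_ordS; have := ltn_ord a; have := ltn_ord b.
    move=> bk ak; have := ltn_ord j; case: (leqP k j) => jk.
      rewrite (eqP jk) !addn0 !modn_small //; case: ifP; case: ifP; lia.
    have [a1|a1] := leqP a j.
      rewrite (@modn_small (a + _)); last lia.
      have [b1|b1] := leqP b j.
        rewrite (@modn_small (b + _)); last lia.
        by case: ifP; case: ifP; lia.
      have -> : (b + (k - j) = (b - j.+1) + k.+1)%N by lia.
      rewrite modnDr modn_small; last lia.
      by case: ifP; case: ifP; lia.
    have -> : (b + (k - j) = (b - j.+1) + k.+1)%N by lia.
    have -> : (a + (k - j) = (a - j.+1) + k.+1)%N by lia.
    rewrite !modnDr !modn_small; try lia.
    by case: ifP; case: ifP; lia.
  rewrite eI /=; set d := iter _ _ c.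
  by apply/imsetP; exists (rev_ord d); rewrite // /window /= subSS.
have -> : minor p I =
    \det (colsub (iter (k - j) (@ordS k.+1)) (colsub (window j) p)).
  by congr (\det _); apply/matrixP=> r c; rewrite !mxE enumI.
rewrite det_colsub_iter_ordS /coefficient; congr (_ * _).
rewrite /twist_sign ltnS subSS; case: ltnP => jk; last by rewrite (eqP jk) mul0n.
rewrite -signr_odd -[RHS]signr_odd; congr (_ ^+ (nat_of_bool _)).
by rewrite !oddM oddS oddB 1?ltnW //; case: (odd k); case: (odd j).
Qed.

(** * The twist on the coordinate ring *)

Lemma subalg_ind (C A : comNzRingType) (iota : {rmorphism C -> A})
    (S : A -> Prop) (P : subalg iota S -> Prop) :
  (forall c, P (subalg_const iota S c)) ->
  (forall f, S (val f) -> P f) ->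
  (forall f g, P f -> P g -> P (f + g)) ->
  (forall f g, P f -> P g -> P (f * g)) ->
  forall f, P f.
Proof.
move=> Pconst Pgen Padd Pmul.
suff ind a : generated iota S a -> forall f, val f = a -> P f.
  by move=> f; apply: (ind (val f)) => //; exact/asboolP/(valP f).
elim=> [c f fc|b Sb f fb|b c gb IHb gc IHc f fbc|b c gb IHb gc IHc f fbc].
- by rewrite (_ : f = subalg_const iota S c) //; exact: val_inj.
- by apply: Pgen; rewrite fb.
- pose g : subalg iota S := Subalg (introT (asboolP _) gb).
  pose h : subalg iota S := Subalg (introT (asboolP _) gc).
  rewrite (_ : f = g + h); last exact: val_inj.
  by apply: Padd; [apply: IHb | apply: IHc].
- pose g : subalg iota S := Subalg (introT (asboolP _) gb).
  pose h : subalg iota S := Subalg (introT (asboolP _) gc).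
  rewrite (_ : f = g * h); last exact: val_inj.
  by apply: Pmul; [apply: IHb | apply: IHc].
Qed.

Lemma map_mx_iterS (A : Type) (f : A -> A) m k n (M : 'M[A]_(k, n)) :
  map_mx (iter m.+1 f) M = map_mx f (map_mx (iter m f) M).
Proof. by apply/matrixP=> r c; rewrite !mxE. Qed.

Section Generic.
Variables (R : realType) (k n : nat).

HB.instance Definition _ :=
  GRing.RMorphism.copy (@twist_poly R k n)
    (comp_mpoly [tuple mxvec (twist_mx (generic_mx R k n)) 0 m | m < k * n]).

Lemma meval_generic_mx (p : 'M_(k, n)) :
  map_mx (meval (mxvec p 0)) (generic_mx R k n) = p.
Proof.
by apply/matrixP=> r c; rewrite [LHS]mxE [X in meval _ X]mxE mevalXU mxvecE.
Qed.

(** Specialise to the matrix whose columns h r are the basis vectors. *)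
Lemma det_colsub_generic_neq0 (h : 'I_k -> 'I_n) :
  injective h -> \det (colsub h (generic_mx R k n)) != 0.
Proof.
move=> hi; pose p : 'M[R[i]]_(k, n) := \matrix_(r, i) (i == h r)%:R.
apply: contraNneq (oner_neq0 R[i]) => det0.
have := congr1 (meval (mxvec p 0)) det0.
rewrite -det_map_mx map_mxsub meval_generic_mx rmorph0 => <-.
rewrite -(det1 R[i] k); apply/eqP; congr (\det _).
by apply/matrixP=> r c; rewrite !mxE (inj_eq hi) eq_sym.
Qed.

Lemma map_twist_poly_generic :
  map_mx (@twist_poly R k n) (generic_mx R k n) = twist_mx (generic_mx R k n).
Proof.
apply/matrixP=> r c; rewrite [LHS]mxE.
have -> : generic_mx R k n r c = 'X_(mxvec_index r c) by rewrite mxE.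
apply: etrans; first exact: comp_mpolyXU.
by rewrite -tnth_nth tnth_mktuple mxvecE.
Qed.

Lemma twist_poly2_generic r c :
  twist_poly (twist_poly (generic_mx R k n r c)) =
  twist_mx (twist_mx (generic_mx R k n)) r c.
Proof.
have entry (M : 'M_(k, n)) :
    twist_poly (M r c) = map_mx (@twist_poly R k n) M r c by rewrite [RHS]mxE.
rewrite entry map_twist_poly_generic entry.
have -> : map_mx (@twist_poly R k n) (twist_mx (generic_mx R k n)) =
    twist_mx (map_mx (@twist_poly R k n) (generic_mx R k n)).
  exact: map_twist_mx.
by rewrite map_twist_poly_generic.
Qed.

Lemma val_GrM (f g : Gr_ring R k n) : val (f * g) = val f * val g.
Proof. by []. Qed.

Lemma val_Gr_prod (J : finType) (F : J -> Gr_ring R k n) :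
  val (\prod_c F c) = \prod_c val (F c).
Proof. exact: (rmorph_prod (val : Gr_ring R k n -> coord_ring R k n)). Qed.

Lemma val_twist (f : Gr_ring R k n) :
  val (@twist R k n f) = twist_poly (val f).
Proof. by []. Qed.

Lemma val_iter_twist m (f : Gr_ring R k n) :
  val (iter m (@twist R k n) f) = iter m (@twist_poly R k n) (val f).
Proof.
by elim: m => [|m IH]; rewrite ?iterS -?IH //; exact: erefl.
Qed.

Lemma iter_twist_poly_minor m (I : ksubset k n) :
  iter m (@twist_poly R k n) (minor (generic_mx R k n) I) =
  minor (map_mx (iter m (@twist_poly R k n)) (generic_mx R k n)) I.
Proof.
elim: m => [|m IH].
  by congr (minor _ I); apply/matrixP=> r c; rewrite [RHS]mxE.
by rewrite iterS IH map_mx_iterS; exact: (map_minor (@twist_poly R k n)).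
Qed.

Lemma iter_twistD m (f g : Gr_ring R k n) :
  iter m (@twist R k n) (f + g) =
  iter m (@twist R k n) f + iter m (@twist R k n) g.
Proof. by elim: m => //= m ->; rewrite rmorphD. Qed.

Lemma iter_twistM m (f g : Gr_ring R k n) :
  iter m (@twist R k n) (f * g) =
  iter m (@twist R k n) f * iter m (@twist R k n) g.
Proof. by elim: m => //= m ->; rewrite rmorphM. Qed.

Lemma iter_twist1 m : iter m (@twist R k n) 1 = 1.
Proof. by elim: m => //= m ->; rewrite rmorph1. Qed.

Lemma iter_twist_const m (c : R[i]) :
  iter m (@twist R k n) (subalg_const _ _ c) = subalg_const _ _ c.
Proof.
by elim: m => //= m ->; apply/val_inj; rewrite /= /twist_poly comp_mpolyC.
Qed.

(** Both sides are ring morphisms that agree on constants. *)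
Lemma eq_iter_twist_on_plucker m
    (pi : {rmorphism Gr_ring R k n -> Gr_ring1 R k n}) :
  (forall I, pi (iter m (@twist R k n) (plucker R I)) = pi (plucker R I)) ->
  pi \o iter m (@twist R k n) =1 pi.
Proof.
move=> piI; apply: (@subalg_ind _ _ _ _ (fun f => (pi \o _) f = pi f)).
- by move=> c; rewrite /comp iter_twist_const.
- move=> f [I fI]; have -> : f = plucker R I by apply: val_inj; exact: fI.
  by rewrite /comp piI.
- by move=> f g; rewrite /comp iter_twistD !rmorphD => -> ->.
- by move=> f g; rewrite /comp iter_twistM !rmorphM => -> ->.
Qed.

End Generic.

(** * Elements whose twists all project to 1 *)

Section Coefs.
Variables (R : realType) (k n : nat) (kn : (k < n)%N).
Local Notation x := (generic_mx R k.+1 n).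
Local Notation T := (@twist R k.+1 n).

Lemma card_coef_set_eq (j : 'I_n) : #|coef_set k.+1 j| == k.+1.
Proof. by rewrite card_coef_set. Qed.

Definition coef_ksubset (j : 'I_n) : ksubset k.+1 n :=
  exist _ (coef_set k.+1 j) (card_coef_set_eq j).

Definition Gr_coef (j : 'I_n) : Gr_ring R k.+1 n := plucker R (coef_ksubset j).

Lemma val_Gr_coef j : val (Gr_coef j) = coefficient x j.
Proof. exact: minor_coef_set. Qed.

Lemma det_window_generic_neq0 (j : 'I_n) : \det (colsub (window j) x) != 0.
Proof.
apply: det_colsub_generic_neq0 => a b /iter_ord_pred_inj ab; apply/val_inj.
by have := ab _ _; have := ltn_ord a; have := ltn_ord b; rewrite /=; lia.
Qed.

Lemma twist_Gr_coef j :
  T (Gr_coef j) = \prod_(c < k) Gr_coef (window j (widen_ord (leqnSn k) c)).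
Proof.
apply/val_inj; rewrite val_twist val_Gr_prod.
rewrite -[val (Gr_coef j)]/(minor x (coef_ksubset j)) twist_poly_minor.
rewrite (@minor_coef_set _ _ _ _ j) //.
rewrite coefficient_twist ?det_window_generic_neq0 //.
by apply: eq_bigr => c _; rewrite -val_Gr_coef.
Qed.

Variables (pi : {rmorphism Gr_ring R k.+1 n -> Gr_ring1 R k.+1 n}).
Hypothesis hpi : is_projection pi.

(** The powers m > 0 are included so that the property is stable under the twist. *)
Definition coef_trivial (f : Gr_ring R k.+1 n) : Prop :=
  forall m, pi (iter m T f) = 1.

Lemma coef_trivial1 : coef_trivial 1.
Proof. by move=> m; rewrite iter_twist1 rmorph1. Qed.

Lemma coef_trivialM f g :
  coef_trivial f -> coef_trivial g -> coef_trivial (f * g).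
Proof. by move=> hf hg m; rewrite iter_twistM rmorphM hf hg mulr1. Qed.

Lemma coef_trivial_prod (J : finType) (F : J -> Gr_ring R k.+1 n) :
  (forall c, coef_trivial (F c)) -> coef_trivial (\prod_c F c).
Proof.
move=> hF; apply: big_ind => // [|f g]; first exact: coef_trivial1.
exact: coef_trivialM.
Qed.

Lemma coef_trivial_twist f : coef_trivial f -> coef_trivial (T f).
Proof. by move=> hf m; rewrite -iterSr. Qed.

Lemma coef_trivial_Gr_coef j : coef_trivial (Gr_coef j).
Proof.
move=> m; elim: m j => [|m IH] j; first exact: (projection_coef hpi (i := j)).
rewrite iterSr twist_Gr_coef.
rewrite (big_morph _ (iter_twistM m) (iter_twist1 R k.+1 n m)).
by rewrite rmorph_prod big1.
Qed.

End Coefs.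

(** * Iterating the double twist *)

(** The left-hand side is the sign in [twist_twist].  The product of the
    two twist signs is (-1)^(k+1) when i lies among the first k+2 columns, that is
    when stepping back by k+2 wraps around, and 1 otherwise. *)
Lemma twist_sign_wrap (A : comNzRingType) k n (i : 'I_n) : (k.+1 < n)%N ->
  (-1) ^+ k.+1 * twist_sign A k.+2 i.+1 * twist_sign A k.+2 (ord_pred i).+1 =
  (-1) ^+ (k.+1 * (i < k.+2).+1).
Proof.
move=> kn; have -> : nat_of_ord (ord_pred i) =
    (if i == 0 :> nat then n.-1 else i.-1)%N.
  have := ltn_ord i; rewrite /=; case: eqP => [->|ni] ilt.
    by rewrite add0n modn_small //; lia.
  have -> : ((i + n).-1 = i.-1 + n)%N by lia.
  by rewrite modnDr modn_small //; lia.
rewrite /twist_sign; have in_ := ltn_ord i.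
case: eqP => i0.
  rewrite i0 ltnS ltn0Sn /= prednK; last lia.
  have -> : (n < k.+2)%N = false by lia.
  by rewrite mulr1 -exprD subSS subn0 mul1n muln2 addnn.
rewrite prednK; last lia.
case: (ltngtP i k.+2) => [ik|ik|ik].
- rewrite muln2 -addnn.
  case: ltnP => ik1.
    have [d kd] : exists d, k = (i + d)%N by exists (k - i)%N; lia.
    have -> : (k.+2 - i.+1 = d.+1)%N by lia.
    have -> : (k.+2 - i = d.+2)%N by lia.
    rewrite -mulrA -!exprD addnn -[RHS]signr_odd odd_double -signr_odd.
    have -> : (k.+1 + (i.+1 * d.+1 + i * d.+2) =
        (2 * i + d + 1 + i * d).*2)%N by rewrite kd; lia.
    by rewrite odd_double.
  have -> : nat_of_ord i = k.+1 by lia.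
  by rewrite mulr1 -exprD subSnn muln1.
- have -> /= : (i.+1 < k.+2)%N = false by lia.
  by rewrite !mulr1 muln1.
- have -> /= : (i.+1 < k.+2)%N = false by lia.
  by rewrite !mulr1 muln1.
Qed.

Section Main.
Variables (R : realType) (k n : nat) (kn : (k.+1 < n)%N).
Variables (pi : {rmorphism Gr_ring R k.+2 n -> Gr_ring1 R k.+2 n}).
Hypothesis hpi : is_projection pi.
Local Notation x := (generic_mx R k.+2 n).
Local Notation T := (@twist R k.+2 n).
Local Notation T' := (@twist_poly R k.+2 n).

(** Here w counts how often the index wraps around, and the first equation says
    where it ends. *)
Lemma iter_twist_generic m (i : 'I_n) :
  exists (w : nat) (j : 'I_n) (L : Gr_ring R k.+2 n),
  [/\ (i + w * n = m * k.+2 + j)%N, coef_trivial pi L &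
    forall r, iter (2 * m) T' (x r i) =
      (-1) ^+ (k.+1 * (m + w)) * val L * x r j].
Proof.
elim: m => [|m [w [j [L [ew triv_L IH]]]]].
  exists 0%N, i, 1; split=> [|| r].
  - by rewrite mul0n addn0.
  - exact: coef_trivial1.
  - by rewrite !muln0 expr0 mul1r (_ : val 1 = 1) ?mul1r.
exists (w + (j < k.+2))%N, (iter k.+2 (@ord_pred n) j),
  (T (T L) * \prod_(c < k) Gr_coef R kn (iter (k.+1 - c) (@ord_pred n) j)).
split=> [||r].
- rewrite -/(val (iter _ _ _)) val_iter_ord_pred // mulnDl addnA ew mulSn.
  by have := ltn_ord j; case: (ltnP j k.+2) => /= jk; lia.
- apply: coef_trivialM; first by do 2 apply: coef_trivial_twist.
  by apply: coef_trivial_prod => c; exact: coef_trivial_Gr_coef.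
- rewrite mulnS add2n !iterS IH.
  have T2E e a : T' (T' ((-1) ^+ e * a * x r j)) =
      (-1) ^+ e * T' (T' a) * twist_mx (twist_mx x) r j.
    rewrite !rmorphM !rmorphXn !rmorphN1; congr (_ * _).
    exact: twist_poly2_generic.
  rewrite T2E twist_twist ?(det_window_generic_neq0 R kn) // twist_sign_wrap //.
  rewrite val_GrM !val_twist val_Gr_prod.
  (* Naming this factor keeps it an atom of the ring normalisation. *)
  set L2 := T' (T' (val L)).
  rewrite (eq_bigr _ (fun c _ => esym (val_Gr_coef R kn _))).
  have -> : (k.+1 * (m.+1 + (w + (j < k.+2))) =
     k.+1 * (m + w) + k.+1 * (j < k.+2).+1)%N by lia.
  by rewrite exprD; ring.
Qed.

Lemma iter_twist_plucker (I : ksubset k.+2 n) :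
  exists2 L, coef_trivial pi L & iter (2 * n) T (plucker R I) = L * plucker R I.
Proof.
have /choice [L hL] : forall i : 'I_n, exists L : Gr_ring R k.+2 n,
    coef_trivial pi L /\ forall r, iter (2 * n) T' (x r i) =
      (-1) ^+ (k.+1 * (n + k.+2)) * val L * x r i.
  move=> i; have [w [j [L [ew triv_L hL]]]] := iter_twist_generic n i.
  have [wk ji] : w = k.+2 /\ j = i.
    have := ltn_ord i; have := ltn_ord j => jn in_.
    (* In i + w n = n (k+2) + j both i and j are less than n. *)
    have wk : w = k.+2 by nia.
    by split=> //; apply/val_inj; move: ew; rewrite wk /=; lia.
  by exists L; split=> // r; rewrite hL wk ji.
exists (\prod_c L (ksubset_nth I c)).
  by apply: coef_trivial_prod => c; case: (hL (ksubset_nth I c)).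
apply/val_inj; rewrite val_iter_twist /= iter_twist_poly_minor /minor.
pose s : coord_ring R k.+2 n := (-1) ^+ (k.+1 * (n + k.+2)).
pose d : 'rV[coord_ring R k.+2 n]_k.+2 := \row_c (s * val (L (ksubset_nth I c))).
have -> : colsub (ksubset_nth I) (map_mx (iter (2 * n) T') x) =
    colsub (ksubset_nth I) x *m diag_mx d.
  apply/matrixP=> r c; rewrite mul_mx_diag [LHS]mxE [LHS]mxE [RHS]mxE.
  by rewrite (proj2 (hL _)) [colsub _ _ _ _]mxE [d _ _]mxE mulrC.
rewrite det_mulmx det_diag mulrC.
have -> : \prod_c d 0 c = \prod_c val (L (ksubset_nth I c)).
  rewrite (eq_bigr (fun c => s * val (L (ksubset_nth I c)))) => [|c _].
    (* The sign s occurs k+2 times, its exponent is a multiple of k+1, and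
       (k+1)(k+2) is even. *)
    rewrite big_split /= prodr_const card_ord /s -exprM -signr_odd.
    by rewrite mulnAC oddM oddM [odd k.+2]oddS andbN mul1r.
  by rewrite mxE.
by rewrite -val_Gr_prod.
Qed.
End Main.

Lemma twist_plucker1 (R : realType) n (I : ksubset 1 n) :
  twist (plucker R I) = 1.
Proof.
apply/val_inj; rewrite /= twist_poly_minor /minor.
rewrite (_ : colsub _ _ = 1%:M) ?det1 //.
apply/matrixP=> a b; rewrite !ord1 mxE mxE [cross _ _ _]mxE /twist_sign /= mul1r.
by rewrite /det_last det_mx11 !mxE.
Qed.

Theorem proposition8p9 (R : realType) (k n : nat) (hk : (1 <= k <= n - 1)%N)
    (pi : {rmorphism Gr_ring R k n -> Gr_ring1 R k n})
    (hpi : is_projection pi) :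
  equal_up_to_coefficients pi (iter (2 * n)%N (@twist R k n)) id.
Proof.
suff : pi \o iter (2 * n) (@twist R k n) =1 pi by [].
apply: eq_iter_twist_on_plucker => I.
case: k hk pi hpi I => [//|[|k]] hk pi hpi I.
  have -> : (2 * n = (2 * n).-1.+1)%N by lia.
  rewrite iterSr twist_plucker1 iter_twist1 rmorph1.
  have /cards1P [i Ii] : #|val I| == 1%N by exact: valP I.
  rewrite (projection_coef hpi (i := i)) // Ii.
  apply/setP => j; rewrite inE; apply/eqP/imsetP => [->|[c _ ->]].
    by exists ord0.
  by rewrite ord1.
have kn : (k.+1 < n)%N by lia.
have [L triv_L ->] := iter_twist_plucker kn hpi I.
by rewrite rmorphM (triv_L 0%N) mul1r.
Qed.
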